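(* Let $n\ge1$ be an integer and define $\varepsilon_n>0$ by $(1+\varepsilon_n)^2 = 1+8190\,e^{-n/10}$. Then $$|f(0)| \le (1+\varepsilon_n)\,3n\,\left\|f(t)e^{-9nt/2}\right\|_{L_2[0,1]}\qquad\text{for every } f\in\mathcal{T}_n,$$ and for every choice of real numbers $\lambda_1<\lambda_2<\cdots<\lambda_n$ there exists $f(t)=\sum_{j=1}^n a_je^{i\lambda_jt}$ with $a_j\in\mathbb{C}$ such that $$|f(0)| > 3n\,\left\|f(t)e^{-9nt/2}\right\|_{L_2[0,1]}.$$
   Context: $\mathcal{T}_n$ denotes the set of all functions $f(t)=\sum_{j=1}^n a_j e^{i\lambda_j t}$ ($t\in\mathbb{R}$) with $a_j\in\mathbb{C}$ (possibly zero) and real $\lambda_1<\cdots<\lambda_n$. $\|f(t)e^{-9nt/2}\|_{L_2[0,1]} = (\int_0^1|f(t)|^2e^{-9nt}\,dt)^{1/2}$. *)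

(* Defs.v *)
(* classical reals. Complex numbers are encoded by real and
   imaginary parts; f(t) = sum_{j<n} (p j + i q j) e^{i lam_j t}. *)
From Stdlib Require Import Reals Lra.
Open Scope R_scope.

Fixpoint rsum (g : nat -> R) (n : nat) : R :=
  match n with
  | O => 0
  | S k => rsum g k + g k
  end.

(* real and imaginary parts of f(t) = sum_{j<n} a_j e^{i lam_j t}, a_j = p_j + i q_j *)
Definition expsum_re (n : nat) (lam p q : nat -> R) (t : R) : R :=
  rsum (fun j => p j * cos (lam j * t) - q j * sin (lam j * t)) n.
Definition expsum_im (n : nat) (lam p q : nat -> R) (t : R) : R :=
  rsum (fun j => p j * sin (lam j * t) + q j * cos (lam j * t)) n.

Definition expsum_abs (n : nat) (lam p q : nat -> R) (t : R) : R :=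
  sqrt (expsum_re n lam p q t ^ 2 + expsum_im n lam p q t ^ 2).

Definition weighted_sq (n : nat) (lam p q : nat -> R) (t : R) : R :=
  (expsum_re n lam p q t ^ 2 + expsum_im n lam p q t ^ 2) * exp (- (9 * INR n) * t).

Definition strictly_incr (n : nat) (lam : nat -> R) : Prop :=
  forall j : nat, (S j < n)%nat -> lam j < lam (S j).

(* Main.v *)
Require Import Defs.
From Stdlib Require Import Reals Lra Lia.
From Coquelicot Require Import Coquelicot.
Open Scope R_scope.

(** On [[0, oo)] the sharp constant is exactly [3 n]: the exponentials
    [e^((i lam_j - 9n/2) t)] have a Cauchy Gram matrix, and evaluation at 0 is
    represented by an explicit [R] in their span, obtained from the partial
    fractions of a product of all-pass factors, with [|R|^2 = R 0 = 9 n^2].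
    This [R] is also the extremal function of the lower bound, since truncating
    the norm to [[0, 1]] strictly decreases it. For the upper bound the
    mass on [[1, oo)] is compared with that on [[0, 1]]: Turan's interpolation
    identity [f t = sum_k c_k f (t - (m + 1 + k) h)], with [c] independent of [t],
    is integrated over cells of length [h = 1/(4n)], so the cell number [m + n]
    contributes at most [(sum |c_k|)^2 e^(-9(m+1)/4)] times the mass on [[0, 1]],
    a geometric series over [m >= 3n]. *)

(** * Finite complex and real sums *)

Open Scope C_scope.

Fixpoint csum (g : nat -> C) (n : nat) : C :=
  match n with
  | O => 0
  | S k => csum g k + g k
  end.

Lemma csum_ext n (f g : nat -> C) :
  (forall k, (k < n)%nat -> f k = g k) -> csum f n = csum g n.
Proof.
  induction n as [|n IH]; intros H; simpl; [easy|].
  rewrite IH, H; auto.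
Qed.

Lemma csum_plus n (f g : nat -> C) :
  csum (fun k => f k + g k) n = csum f n + csum g n.
Proof. induction n as [|n IH]; simpl; [|rewrite IH]; ring. Qed.

Lemma csum_scal n (c : C) (f : nat -> C) :
  csum (fun k => c * f k) n = c * csum f n.
Proof. induction n as [|n IH]; simpl; [|rewrite IH]; ring. Qed.

Lemma csum_conj n (f : nat -> C) :
  Cconj (csum f n) = csum (fun k => Cconj (f k)) n.
Proof.
  induction n as [|n IH]; simpl.
  - unfold Cconj; simpl; now rewrite Ropp_0.
  - now rewrite Cplus_conj, IH.
Qed.

Lemma csum_zero n : csum (fun _ => RtoC 0) n = 0.
Proof. induction n as [|n IH]; simpl; [|rewrite IH]; ring. Qed.

Lemma csum_swap n m (f : nat -> nat -> C) :
  csum (fun j => csum (fun k => f j k) m) n =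
  csum (fun k => csum (fun j => f j k) n) m.
Proof.
  induction n as [|n IH]; simpl.
  - now rewrite csum_zero.
  - now rewrite IH, <- csum_plus.
Qed.

Lemma csum_first n (f : nat -> C) :
  csum f (S n) = f 0%nat + csum (fun k => f (S k)) n.
Proof.
  induction n as [|n IH]; [simpl; ring|].
  change (csum f (S n) + f (S n) = f 0%nat + (csum (fun k => f (S k)) n + f (S n))).
  rewrite IH; ring.
Qed.

Lemma re_csum n (f : nat -> C) : Re (csum f n) = rsum (fun k => Re (f k)) n.
Proof. induction n as [|n IH]; simpl; [easy|]. now rewrite <- IH. Qed.

Lemma im_csum n (f : nat -> C) : Im (csum f n) = rsum (fun k => Im (f k)) n.
Proof. induction n as [|n IH]; simpl; [easy|]. now rewrite <- IH. Qed.

Lemma rsum_ext n (f g : nat -> R) :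
  (forall k, (k < n)%nat -> f k = g k) -> rsum f n = rsum g n.
Proof.
  induction n as [|n IH]; intros H; simpl; [easy|].
  rewrite IH, H; auto.
Qed.

Lemma rsum_le n (f g : nat -> R) :
  (forall k, (k < n)%nat -> f k <= g k) -> rsum f n <= rsum g n.
Proof.
  induction n as [|n IH]; intros H; simpl; [lra|].
  apply Rplus_le_compat; auto.
Qed.

Lemma rsum_scal n (c : R) (f : nat -> R) :
  rsum (fun k => (c * f k)%R) n = (c * rsum f n)%R.
Proof. induction n as [|n IH]; simpl; [|rewrite IH]; ring. Qed.

Lemma rsum_scal_r n (c : R) (f : nat -> R) :
  rsum (fun k => (f k * c)%R) n = (rsum f n * c)%R.
Proof. induction n as [|n IH]; simpl; [|rewrite IH]; ring. Qed.

Lemma rsum_plus n (f g : nat -> R) :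
  rsum (fun k => (f k + g k)%R) n = (rsum f n + rsum g n)%R.
Proof. induction n as [|n IH]; simpl; [|rewrite IH]; ring. Qed.

Lemma rsum_first n (f : nat -> R) :
  rsum f (S n) = (f 0%nat + rsum (fun k => f (S k)) n)%R.
Proof.
  induction n as [|n IH]; [simpl; ring|].
  change (rsum f (S n) + f (S n) = f 0%nat + (rsum (fun k => f (S k)) n + f (S n)))%R.
  rewrite IH; ring.
Qed.

Lemma Cmod_csum_le n (f : nat -> C) : Cmod (csum f n) <= rsum (fun k => Cmod (f k)) n.
Proof.
  induction n as [|n IH]; simpl; [rewrite Cmod_0; lra|].
  eapply Rle_trans; [apply Cmod_triangle|lra].
Qed.

(** This is the sum of [c k * (x k - s) ^ 2], expanded so that [s] can be optimised afterwards. *)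
Lemma rsum_variance n (c x : nat -> R) (s : R) :
  (forall k, (k < n)%nat -> 0 <= c k) ->
  (0 <= rsum (fun k => c k * x k ^ 2) n - 2 * s * rsum (fun k => c k * x k) n
        + s ^ 2 * rsum c n)%R.
Proof.
  intros Hc. induction n as [|n IH]; simpl; [lra|].
  assert (H := IH (fun k Hk => Hc k (Nat.lt_lt_succ_r _ _ Hk))); simpl in H.
  assert (H1 : (0 <= c n * (x n - s) ^ 2)%R)
    by (apply Rmult_le_pos; [apply Hc; lia|apply pow2_ge_0]).
  lra.
Qed.

(** The variance inequality at [s = A / K]; a total weight merely bounded by [K] is enough. *)
Lemma rsum_cauchy_schwarz n (c x : nat -> R) (K : R) :
  0 < K -> rsum c n <= K -> (forall k, (k < n)%nat -> 0 <= c k) ->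
  (rsum (fun k => c k * x k) n ^ 2 <= K * rsum (fun k => c k * x k ^ 2) n)%R.
Proof.
  intros HK HcK Hc.
  set (A := rsum (fun k => c k * x k)%R n).
  assert (H := rsum_variance n c x (A / K) Hc); fold A in H.
  set (D := rsum (fun k => c k * x k ^ 2)%R n) in *.
  assert (H2 : ((A / K) ^ 2 * rsum c n <= (A / K) ^ 2 * K)%R)
    by (apply Rmult_le_compat_l; [apply pow2_ge_0|easy]).
  replace ((A / K) ^ 2 * K)%R with (A ^ 2 / K)%R in H2 by (field; lra).
  replace (2 * (A / K) * A)%R with (2 * (A ^ 2 / K))%R in H by (field; lra).
  assert (H3 : (A ^ 2 / K <= D)%R) by lra.
  apply (Rmult_le_compat_l K) in H3; [|lra].
  replace (K * (A ^ 2 / K))%R with (A ^ 2)%R in H3 by (field; lra). exact H3.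
Qed.

(** * Turan's polynomial and its coefficient bounds *)

(** Here [N] counts coefficients, so the degree is below [N]. Hiding them in an existential leaves
    only the Wiener norm bound [B] to be propagated. *)
Definition poly_fun (N : nat) (B : R) (F : C -> C) : Prop :=
  exists a : nat -> C,
    rsum (fun k => Cmod (a k)) N <= B /\
    forall z, F z = csum (fun k => a k * z ^ k) N.

Lemma poly_fun_le N B B' F : B <= B' -> poly_fun N B F -> poly_fun N B' F.
Proof. intros H [a [Ha HF]]. exists a; split; [lra|easy]. Qed.

Lemma poly_fun_plus N B1 B2 F G :
  poly_fun N B1 F -> poly_fun N B2 G -> poly_fun N (B1 + B2) (fun z => F z + G z).
Proof.
  intros [a [Ha HF]] [b [Hb HG]]. exists (fun k => a k + b k); split.
  - eapply Rle_trans; [apply rsum_le; intros k _; apply Cmod_triangle|].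
    rewrite rsum_plus; lra.
  - intros z. rewrite HF, HG, <- csum_plus. apply csum_ext; intros; ring.
Qed.

Lemma poly_fun_scal N B c F :
  poly_fun N B F -> poly_fun N (Cmod c * B) (fun z => c * F z).
Proof.
  intros [a [Ha HF]]. exists (fun k => c * a k); split.
  - rewrite (rsum_ext _ _ (fun k => Cmod c * Cmod (a k))%R)
      by (intros; apply Cmod_mult).
    rewrite rsum_scal. apply Rmult_le_compat_l; [apply Cmod_ge_0|easy].
  - intros z. rewrite HF, <- csum_scal. apply csum_ext; intros; ring.
Qed.

Lemma poly_fun_widen N B F : poly_fun N B F -> poly_fun (S N) B F.
Proof.
  intros [a [Ha HF]].
  exists (fun k => if Nat.ltb k N then a k else 0); split.
  - simpl. rewrite Nat.ltb_irrefl, Cmod_0, Rplus_0_r.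
    rewrite (rsum_ext _ _ (fun k => Cmod (a k))); [easy|].
    intros k Hk; now rewrite (proj2 (Nat.ltb_lt k N) Hk).
  - intros z; simpl. rewrite Nat.ltb_irrefl, HF.
    rewrite (csum_ext _ (fun k => (if Nat.ltb k N then a k else 0) * z ^ k)
      (fun k => a k * z ^ k)).
    + ring.
    + intros k Hk; now rewrite (proj2 (Nat.ltb_lt k N) Hk).
Qed.

Lemma poly_fun_mulX N B F : poly_fun N B F -> poly_fun (S N) B (fun z => z * F z).
Proof.
  intros [a [Ha HF]].
  exists (fun k => match k with O => RtoC 0 | S i => a i end); split.
  - rewrite rsum_first, Cmod_0, Rplus_0_l. exact Ha.
  - intros z. rewrite csum_first, HF, <- csum_scal.
    rewrite Cmult_0_l, Cplus_0_l. apply csum_ext; intros k _.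
    rewrite Cpow_S; ring.
Qed.

(* Coefficients of the power series [b(z) / (1 - u z)]. *)
Fixpoint geom_div (u : C) (b : nat -> C) (r : nat) : C :=
  match r with
  | O => b O
  | S k => b (S k) + u * geom_div u b k
  end.

(** The recurrence of [geom_div] makes the product telescope; only the overflow term of degree
    [m + 1] survives truncation. *)
Lemma geom_div_trunc u b m z :
  (1 - u * z) * csum (fun r => geom_div u b r * z ^ r) (S m) =
  csum (fun r => b r * z ^ r) (S m) - u * geom_div u b m * z ^ (S m).
Proof.
  induction m as [|m IH]; [simpl; ring|].
  remember (S m) as p. simpl (csum _ (S p)).
  rewrite Cmult_plus_distr_l, IH. subst p.
  rewrite (Cpow_S _ (S m)). simpl geom_div. ring.
Qed.

(* The ratios satisfy [1/4 + 3/4 = 1], so the bound [4^n (4/3)^r] is preserved. *)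
Lemma geom_div_bound u b n :
  Cmod u = 1%R -> (forall r, Cmod (b r) <= 4 ^ n * (4/3) ^ r) ->
  forall r, Cmod (geom_div u b r) <= 4 ^ (S n) * (4/3) ^ r.
Proof.
  intros Hu Hb. assert (H4 : (0 < 4 ^ n)%R) by (apply pow_lt; lra).
  induction r as [|r IH].
  - generalize (Hb O); simpl; lra.
  - simpl geom_div. eapply Rle_trans; [apply Cmod_triangle|].
    rewrite Cmod_mult, Hu. generalize (Hb (S r)); simpl in *; lra.
Qed.

(* With [Q = prod (1 - z / w_j)] and [S] the degree-[m] truncation of [1/Q],
   [1 - Q S] has order [m+1] and degree at most [m+n], and equals 1 at each [w_j]. *)
Lemma turan_polynomial (m n : nat) (w : nat -> C) :
  (forall j, Cmod (w j) = 1%R) ->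
  exists (Q P : C -> C) (b : nat -> C),
    poly_fun (S n) (2 ^ n) Q /\ poly_fun n ((4/3) ^ m * 8 ^ n) P /\
    (forall r, Cmod (b r) <= 4 ^ n * (4/3) ^ r) /\
    (forall z, 1 - z ^ (S m) * P z = Q z * csum (fun r => b r * z ^ r) (S m)) /\
    (forall j, (j < n)%nat -> Q (w j) = 0).
Proof.
  intros Hw. induction n as [|n (Q & P & b & HQ & HP & Hb & HE & HZ)].
  - exists (fun _ => RtoC 1), (fun _ => RtoC 0),
      (fun r => match r with O => RtoC 1 | _ => RtoC 0 end).
    split; [|split; [|split; [|split]]].
    + exists (fun _ => RtoC 1); split; [simpl; rewrite Cmod_1; lra|].
      intros z; simpl; ring.
    + exists (fun _ => RtoC 0); split; [|easy].
      simpl. apply Rmult_le_pos; [apply pow_le|]; lra.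
    + intros [|r]; [rewrite Cmod_1; simpl; lra|].
      rewrite Cmod_0. simpl. rewrite Rmult_1_l. apply Rmult_le_pos; [lra|apply pow_le; lra].
    + intros z. rewrite csum_first.
      rewrite (csum_ext m _ (fun _ => RtoC 0)) by (intros; ring).
      rewrite csum_zero. simpl (z ^ 0). ring.
    + lia.
  - set (u := / w n).
    assert (Hwn : w n <> 0).
    { intros E. generalize (Hw n). rewrite E, Cmod_0. lra. }
    assert (Hu : Cmod u = 1%R) by (unfold u; rewrite Cmod_inv, Hw by easy; lra).
    assert (Hb' := geom_div_bound u b n Hu Hb).
    set (beta := u * geom_div u b m).
    (* [Q] gains the factor [1 - u z], which vanishes at [w n]; [P] absorbs the overflow of
       [geom_div_trunc], multiplied by the old [Q]. *)
    exists (fun z => Q z + (- u) * (z * Q z)), (fun z => P z + beta * Q z),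
      (geom_div u b).
    split; [|split; [|split; [|split]]].
    + apply (poly_fun_le _ (2 ^ n + Cmod (- u) * 2 ^ n)).
      { rewrite Cmod_opp, Hu. simpl. lra. }
      apply poly_fun_plus; [now apply poly_fun_widen|].
      apply poly_fun_scal. now apply poly_fun_mulX.
    + apply (poly_fun_le _ ((4/3) ^ m * 8 ^ n + Cmod beta * 2 ^ n)).
      { unfold beta. rewrite Cmod_mult, Hu, Rmult_1_l.
        assert (H2 : (0 < 2 ^ n)%R) by (apply pow_lt; lra).
        assert (H3 : (0 < (4/3) ^ m)%R) by (apply pow_lt; lra).
        (* Since [4 ^ S n * 2 ^ n] is [4 * 8 ^ n], the bound grows by a factor 5, which is below
           8. *)
        apply Rle_trans with ((4/3) ^ m * 8 ^ n + 4 ^ S n * (4/3) ^ m * 2 ^ n)%R.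
        - apply Rplus_le_compat_l, Rmult_le_compat_r; [lra|easy].
        - replace (8 ^ n)%R with (4 ^ n * 2 ^ n)%R
            by (rewrite <- Rpow_mult_distr; f_equal; lra).
          simpl (8 ^ S n)%R.
          replace (8 ^ n)%R with (4 ^ n * 2 ^ n)%R
            by (rewrite <- Rpow_mult_distr; f_equal; lra).
          simpl (4 ^ S n)%R.
          assert (0 < (4/3) ^ m * (4 ^ n * 2 ^ n))%R.
          { repeat apply Rmult_lt_0_compat; try lra. apply pow_lt; lra. }
          lra. }
      apply poly_fun_plus; [now apply poly_fun_widen|].
      now apply poly_fun_scal.
    + exact Hb'.
    + intros z.
      replace (Q z + - u * (z * Q z)) with (Q z * (1 - u * z)) by ring.
      rewrite <- Cmult_assoc, geom_div_trunc.
      replace (1 - z ^ S m * (P z + beta * Q z))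
        with ((1 - z ^ S m * P z) - z ^ S m * beta * Q z) by ring.
      rewrite HE. unfold beta. ring.
    + intros j Hj. destruct (Nat.eq_dec j n) as [->|Hne].
      * unfold u. field. easy.
      * rewrite HZ by lia. ring.
Qed.

(** * Exponential sums and their backward shifts *)

Definition cis (x : R) : C := (cos x, sin x).

Lemma cis_plus x y : cis (x + y) = cis x * cis y.
Proof. apply injective_projections; simpl; [rewrite cos_plus|rewrite sin_plus]; ring. Qed.

Lemma cis_0 : cis 0 = 1.
Proof. unfold cis. now rewrite cos_0, sin_0. Qed.

Lemma cis_pow x n : cis x ^ n = cis (INR n * x).
Proof.
  induction n as [|n IH].
  - now rewrite Rmult_0_l, cis_0.
  - rewrite Cpow_S, IH, <- cis_plus, S_INR. f_equal; ring.
Qed.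

Lemma cis_conj x : Cconj (cis x) = cis (- x).
Proof. unfold Cconj, cis; simpl. now rewrite cos_neg, sin_neg. Qed.

Lemma Cmod_cis x : Cmod (cis x) = 1%R.
Proof.
  unfold Cmod, cis; simpl.
  transitivity (sqrt 1); [f_equal|apply sqrt_1].
  transitivity (Rsqr (sin x) + Rsqr (cos x))%R; [unfold Rsqr; ring|apply sin2_cos2].
Qed.

Definition expsum (n : nat) (lam : nat -> R) (a : nat -> C) (t : R) : C :=
  csum (fun j => a j * cis (lam j * t)) n.

(** Turan's polynomial [z ^ S m * P z] equals 1 at each node [cis (- (lam j * h))]. Multiplied by
    [a j * cis (lam j * t)], powers of the node become shifts by multiples of [h]. The sign of [h]
    is free, as [energy_pos] requires. *)
Lemma expsum_shift (n m : nat) (lam : nat -> R) (h : R) :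
  exists c : nat -> C,
    rsum (fun k => Cmod (c k)) n <= (4/3) ^ m * 8 ^ n /\
    forall a t, expsum n lam a t =
      csum (fun k => c k * expsum n lam a (t - INR (S m + k) * h)) n.
Proof.
  destruct (turan_polynomial m n (fun j => cis (- (lam j * h))))
    as (Q & P & b & _ & (c & Hc & HP) & _ & HE & HZ).
  { intros; apply Cmod_cis. }
  exists c; split; [exact Hc|]. intros a t. unfold expsum.
  rewrite (csum_ext _
    (fun k => c k * csum (fun j => a j * cis (lam j * (t - INR (S m + k) * h))) n)
    (fun k => csum (fun j => c k * (a j * cis (lam j * (t - INR (S m + k) * h)))) n))
    by (intros; now rewrite csum_scal).
  rewrite csum_swap. apply csum_ext; intros j Hj.
  set (w := cis (- (lam j * h))).
  assert (H1 : w ^ S m * P w = 1).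
  { assert (H := HE w). unfold w at 3 in H. rewrite HZ in H by easy.
    replace (w ^ S m * P w) with (1 - (1 - w ^ S m * P w)) by ring.
    rewrite H; ring. }
  rewrite (csum_ext _ _ (fun k => (a j * cis (lam j * t) * w ^ S m) * (c k * w ^ k))).
  - rewrite csum_scal, <- HP, <- Cmult_assoc, H1. ring.
  - intros k _. replace (lam j * (t - INR (S m + k) * h))%R
      with (lam j * t + INR (S m + k) * - (lam j * h))%R by ring.
    rewrite cis_plus, <- cis_pow, Cpow_add_r. fold w. ring.
Qed.

Lemma exp_nondecreasing x y : x <= y -> exp x <= exp y.
Proof.
  intros [H| ->]; [left; now apply exp_increasing|apply Rle_refl].
Qed.

Definition wsq (n : nat) (lam : nat -> R) (al : R) (a : nat -> C) (t : R) : R :=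
  (Cmod (expsum n lam a t) ^ 2 * exp (- al * t))%R.

Lemma wsq_nonneg n lam al a t : 0 <= wsq n lam al a t.
Proof.
  apply Rmult_le_pos; [apply pow2_ge_0|left; apply exp_pos].
Qed.

(** Cauchy-Schwarz with weights [Cmod (c k)] squares the shift identity. Every shift is at least
    [(m + 1) h], and the exponential weight turns this into the decay factor. *)
Lemma wsq_shift (n m : nat) (lam : nat -> R) (al h : R) :
  (0 < al)%R -> (0 < h)%R ->
  exists c : nat -> R,
    (forall k, 0 <= c k) /\
    rsum c n <= (4/3) ^ m * 8 ^ n /\
    forall a t, (wsq n lam al a t <=
      (4/3) ^ m * 8 ^ n * exp (- al * (INR (S m) * h)) *
      rsum (fun k => c k * wsq n lam al a (t - INR (S m + k) * h)) n)%R.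
Proof.
  intros Hal Hh. destruct (expsum_shift n m lam h) as (c & Hc & HF).
  exists (fun k => Cmod (c k)). split; [intros; apply Cmod_ge_0|split; [exact Hc|]].
  intros a t. unfold wsq.
  set (f := expsum n lam a). set (K := ((4/3) ^ m * 8 ^ n)%R) in *.
  assert (HK : (0 < K)%R)
    by (unfold K; apply Rmult_lt_0_compat; apply pow_lt; lra).
  assert (H1 : (Cmod (f t) ^ 2 <=
    K * rsum (fun k => Cmod (c k) * Cmod (f (t - INR (S m + k) * h)) ^ 2) n)%R).
  { eapply Rle_trans; [|apply (rsum_cauchy_schwarz n _ _ K); auto].
    - apply pow_incr; split; [apply Cmod_ge_0|].
      unfold f at 1. rewrite HF. eapply Rle_trans; [apply Cmod_csum_le|].
      apply rsum_le; intros k _. rewrite Cmod_mult. apply Rle_refl.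
    - intros; apply Cmod_ge_0. }
  eapply Rle_trans.
  { apply Rmult_le_compat_r; [left; apply exp_pos|exact H1]. }
  rewrite !Rmult_assoc. apply Rmult_le_compat_l; [lra|].
  rewrite <- rsum_scal, <- rsum_scal_r. apply rsum_le; intros k _.
  set (s := (INR (S m + k) * h)%R).
  replace (exp (- al * t)) with (exp (- al * (t - s)) * exp (- al * s))%R
    by (rewrite <- exp_plus; f_equal; ring).
  assert (Hs : exp (- al * s) <= exp (- al * (INR (S m) * h))).
  { apply exp_nondecreasing. unfold s. rewrite plus_INR.
    assert (0 <= al * (INR k * h))%R
      by (repeat apply Rmult_le_pos; try lra; apply pos_INR). lra. }
  assert (0 <= Cmod (c k) * Cmod (f (t - s)) ^ 2 * exp (- al * (t - s)))%R.
  { apply Rmult_le_pos; [|left; apply exp_pos].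
    apply Rmult_le_pos; [apply Cmod_ge_0|apply pow2_ge_0]. }
  eapply Rle_trans with
    ((Cmod (c k) * Cmod (f (t - s)) ^ 2 * exp (- al * (t - s))) * exp (- al * s))%R.
  - right; ring.
  - eapply Rle_trans; [apply Rmult_le_compat_l; [easy|apply Hs]|]. right; ring.
Qed.

(** * The Cauchy kernel and the linear system of the extremal function *)

(** The integral of [exp (- al t) * cis (x t)] over [t >= 0]: the weighted inner product of two
    exponentials whose frequencies differ by [x]. *)
Definition kern (al x : R) : C := / (RtoC al - Ci * RtoC x).

Lemma kern_denom_neq_0 al x : (0 < al)%R -> RtoC al - Ci * RtoC x <> 0.
Proof.
  intros Hal H. apply (f_equal Re) in H. simpl in H. lra.
Qed.

Lemma kern_conj al x : (0 < al)%R -> Cconj (kern al x) = kern al (- x).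
Proof.
  intros Hal. unfold kern.
  rewrite Cinv_conj by now apply kern_denom_neq_0. f_equal.
  apply injective_projections; simpl; ring.
Qed.

(** A resolvent identity, which splits a product of two kernels into partial fractions. *)
Lemma kern_diff al x mu nu : (0 < al)%R ->
  kern al (x - mu) - kern al (x - nu) =
  Ci * RtoC (nu - mu) * kern al (x - mu) * kern al (x - nu).
Proof.
  intros Hal. unfold kern.
  assert (H1 := kern_denom_neq_0 al (x - mu) Hal).
  assert (H2 := kern_denom_neq_0 al (x - nu) Hal).
  rewrite !RtoC_minus in *. field. split; easy.
Qed.

(* Partial fractions of the all-pass product
   [prod_k (1 - al / (al - i (x - lam k)))], which vanishes at each [x = lam j]. *)
Lemma cauchy_system (n : nat) (lam : nat -> R) (al : R) :
  (0 < al)%R -> (forall j k, (j < k < n)%nat -> lam j <> lam k) ->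
  exists s : nat -> C,
    csum s n = RtoC (INR n * al) /\
    forall j, (j < n)%nat -> csum (fun k => s k * kern al (lam j - lam k)) n = 1.
Proof.
  intros Hal. induction n as [|n IH]; intros Hlam.
  { exists (fun _ => RtoC 0). split; [simpl; now rewrite Rmult_0_l|lia]. }
  destruct IH as (s & Hsum & Hs).
  { intros j k Hjk; apply Hlam; lia. }
  set (d := fun k => Ci * RtoC (lam n - lam k)).
  assert (Hd : forall k, (k < n)%nat -> d k <> 0).
  { intros k Hk H. apply (f_equal Im) in H. unfold d in H; simpl in H.
    apply (Hlam k n); [lia|]. lra. }
  set (T := csum (fun k => s k / d k) n).
  (* These are the partial fraction coefficients after multiplying
     [1 - sum_k s k * kern al (x - lam k)] by [1 - al * kern al (x - lam n)]; the terms in [T]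
     cancel in their sum, which grows by exactly [al]. *)
  exists (fun k => if Nat.ltb k n then s k * (1 - RtoC al / d k) else RtoC al * (1 + T)).
  assert (Hext : forall g : nat -> C,
    csum (fun k => (if Nat.ltb k n then s k * (1 - RtoC al / d k)
                    else RtoC al * (1 + T)) * g k) (S n) =
    csum (fun k => s k * g k) n - RtoC al * csum (fun k => s k / d k * g k) n
    + RtoC al * (1 + T) * g n).
  { intros g. simpl. rewrite Nat.ltb_irrefl. f_equal.
    rewrite (csum_ext _ _ (fun k => s k * g k + (- RtoC al) * (s k / d k * g k))).
    - rewrite csum_plus, csum_scal. ring.
    - intros k Hk. rewrite (proj2 (Nat.ltb_lt k n) Hk). field. auto. }
  split.
  - rewrite (csum_ext _ _ (fun k => (if Nat.ltb k n then s k * (1 - RtoC al / d k)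
                    else RtoC al * (1 + T)) * 1)) by (intros; ring).
    rewrite Hext.
    rewrite (csum_ext _ (fun k => s k * 1) s) by (intros; ring).
    rewrite (csum_ext _ (fun k => s k / d k * 1) (fun k => s k / d k)) by (intros; ring).
    fold T. rewrite Hsum, S_INR, Rmult_plus_distr_r, Rmult_1_l, RtoC_plus. ring.
  - intros j Hj. rewrite Hext.
    set (X := csum (fun k => s k * kern al (lam j - lam k)) n).
    assert (HX : csum (fun k => s k / d k * kern al (lam j - lam k)) n =
      T * kern al (lam j - lam n) + X * kern al (lam j - lam n)).
    { unfold T, X. rewrite (Cmult_comm (csum _ _)), (Cmult_comm (csum _ _)).
      rewrite <- !csum_scal, <- csum_plus.
      apply csum_ext; intros k Hk.
      replace (kern al (lam j - lam k)) with
        (kern al (lam j - lam n) + d k * kern al (lam j - lam k) * kern al (lam j - lam n)) at 1.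
      - field. auto.
      - unfold d. rewrite <- kern_diff by easy. ring. }
    (* At [j = n] the new factor vanishes, as [kern al 0 = / al]; at earlier nodes the old product
       vanishes, that is [X = 1]. *)
    rewrite HX. destruct (Nat.eq_dec j n) as [->|Hne].
    + replace (kern al (lam n - lam n)) with (/ RtoC al).
      * field. intros H. apply RtoC_inj in H. lra.
      * unfold kern. f_equal. rewrite Rminus_diag. ring.
    + unfold X. rewrite Hs by lia. ring.
Qed.

(** * The tail energy: derivative, limit and sign *)

(* [gram a] is the squared norm of [expsum a] in [L_2([0, oo), exp (- al t) dt]. *)
Definition gram (n : nat) (lam : nat -> R) (al : R) (a : nat -> C) : C :=
  csum (fun j => a j * csum (fun k => Cconj (a k) * kern al (lam j - lam k)) n) n.

(** The mass of [wsq] on [[t, oo)]: translating by [t] rotates the coefficients and scales the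
    weight. This closed form replaces improper integrals; it is handled through its derivative
    [- wsq] and its limit 0. *)
Definition energy (n : nat) (lam : nat -> R) (al : R) (a : nat -> C) (t : R) : R :=
  (exp (- al * t) * Re (gram n lam al (fun j => a j * cis (lam j * t)%R)%C))%R.

Lemma energy_0 n lam al a : energy n lam al a 0 = Re (gram n lam al a).
Proof.
  unfold energy. rewrite Rmult_0_r, exp_0, Rmult_1_l. f_equal.
  unfold gram. apply csum_ext; intros j _. rewrite Rmult_0_r, cis_0, Cmult_1_r.
  f_equal. apply csum_ext; intros k _. now rewrite Rmult_0_r, cis_0, Cmult_1_r.
Qed.

Definition energy_term (al : R) (z : C) (th t : R) : R :=
  (exp (- al * t) * Re (z * cis (th * t)%R * kern al th)%C)%R.

Lemma energy_split n lam al a t :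
  energy n lam al a t =
  rsum (fun j => rsum (fun k => energy_term al (a j * Cconj (a k))%C (lam j - lam k) t) n) n.
Proof.
  unfold energy, gram, energy_term. rewrite re_csum, <- rsum_scal.
  apply rsum_ext; intros j _. rewrite <- csum_scal, re_csum, <- rsum_scal.
  apply rsum_ext; intros k _. do 2 f_equal.
  rewrite Cmult_conj, cis_conj.
  replace ((lam j - lam k) * t)%R with (lam j * t + - (lam k * t))%R by ring.
  rewrite cis_plus. ring.
Qed.

(** Differentiation produces the factor [- (al - i th)], which cancels [kern al th] up to sign. *)
Lemma energy_term_derive al z th t : (0 < al)%R ->
  is_derive (energy_term al z th) t (- (Re (z * cis (th * t)%R)%C * exp (- al * t)))%R.
Proof.
  intros Hal. destruct z as [x y].
  assert (Hk : kern al th = ((al / (al ^ 2 + th ^ 2))%R, (th / (al ^ 2 + th ^ 2))%R)).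
  { apply injective_projections; simpl; field_simplify_eq; try nra. }
  unfold energy_term. rewrite Hk. unfold cis. simpl.
  auto_derive; [easy|]. field. nra.
Qed.

Lemma rsum_derive n (f : nat -> R -> R) (df : nat -> R) t :
  (forall k, is_derive (f k) t (df k)) ->
  is_derive (fun x => rsum (fun k => f k x) n) t (rsum df n).
Proof.
  intros H. induction n as [|n IH]; simpl.
  - apply (is_derive_const (V := R_NormedModule)).
  - apply (is_derive_plus (V := R_NormedModule)); auto.
Qed.

Lemma Cmod_csum_sqr n (f : nat -> C) :
  (Cmod (csum f n) ^ 2)%R =
  rsum (fun j => rsum (fun k => Re (f j * Cconj (f k))%C) n) n.
Proof.
  apply RtoC_inj. rewrite Cmod2_conj.
  assert (H : csum f n * Cconj (csum f n) =
    csum (fun j => csum (fun k => f j * Cconj (f k)) n) n).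
  { rewrite Cmult_comm, <- csum_scal. apply csum_ext; intros j _.
    now rewrite csum_conj, csum_scal, Cmult_comm. }
  transitivity (RtoC (Re (csum f n * Cconj (csum f n)))).
  - rewrite <- Cmod2_conj. easy.
  - rewrite H, re_csum. f_equal. apply rsum_ext; intros; apply re_csum.
Qed.

Lemma energy_derive n lam al a t : (0 < al)%R ->
  is_derive (energy n lam al a) t (- wsq n lam al a t)%R.
Proof.
  intros Hal. apply (is_derive_ext (fun t =>
    rsum (fun j => rsum (fun k => energy_term al (a j * Cconj (a k))%C (lam j - lam k) t) n) n)).
  { intros; symmetry; apply energy_split. }
  replace (- wsq n lam al a t)%R with
   (rsum (fun j => rsum (fun k =>
      (- (Re (a j * Cconj (a k) * cis ((lam j - lam k) * t)%R)%C * exp (- al * t)))%R) n) n).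
  - apply rsum_derive; intros j. apply rsum_derive; intros k. now apply energy_term_derive.
  - unfold wsq, expsum. rewrite Cmod_csum_sqr.
    replace (- (rsum (fun j => rsum (fun k => Re
       (a j * cis (lam j * t)%R * Cconj (a k * cis (lam k * t)%R))%C) n) n * exp (- al * t)))%R
      with ((- exp (- al * t)) * rsum (fun j => rsum (fun k => Re
       (a j * cis (lam j * t)%R * Cconj (a k * cis (lam k * t)%R))%C) n) n)%R by ring.
    rewrite <- rsum_scal. apply rsum_ext; intros j _.
    rewrite <- rsum_scal. apply rsum_ext; intros k _.
    replace ((lam j - lam k) * t)%R with (lam j * t + - (lam k * t))%R by ring.
    rewrite cis_plus, <- cis_conj, Cmult_conj.
    replace (a j * Cconj (a k) * (cis (lam j * t) * Cconj (cis (lam k * t))))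
      with (a j * cis (lam j * t) * (Cconj (a k) * Cconj (cis (lam k * t)))) by ring.
    ring.
Qed.

Lemma derive_nonpos_decr (f df : R -> R) a b :
  (forall t, is_derive f t (df t)) -> (forall t, a <= t <= b -> df t <= 0) ->
  a <= b -> f b <= f a.
Proof.
  intros Hd Hn Hab. destruct (MVT_gen f a b df) as (c & Hc & E).
  - intros; apply Hd.
  - intros x _. apply derivable_continuous_pt.
    exists (df x). now apply is_derive_Reals.
  - rewrite Rmin_left, Rmax_right in Hc by easy.
    assert (H := Hn c Hc). nra.
Qed.

Lemma energy_decr n lam al a s t : (0 < al)%R -> s <= t ->
  energy n lam al a t <= energy n lam al a s.
Proof.
  intros Hal. apply (derive_nonpos_decr _ (fun t => (- wsq n lam al a t)%R)).
  - intros; now apply energy_derive.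
  - intros u _. generalize (wsq_nonneg n lam al a u). lra.
Qed.

Lemma energy_term_bound al z th t :
  (Rabs (energy_term al z th t) <= Cmod (z * kern al th)%C * exp (- al * t))%R.
Proof.
  unfold energy_term. rewrite Rabs_mult, (Rabs_pos_eq (exp _)) by (left; apply exp_pos).
  rewrite Rmult_comm. apply Rmult_le_compat_r; [left; apply exp_pos|].
  eapply Rle_trans; [apply re_le_Cmod|].
  rewrite !Cmod_mult, Cmod_cis. lra.
Qed.

Lemma rsum_Rabs n (f : nat -> R) : (Rabs (rsum f n) <= rsum (fun k => Rabs (f k)) n)%R.
Proof.
  induction n as [|n IH]; simpl; [rewrite Rabs_R0; lra|].
  eapply Rle_trans; [apply Rabs_triang|lra].
Qed.

Lemma energy_bound n lam al a :
  exists M, forall t, (Rabs (energy n lam al a t) <= M * exp (- al * t))%R.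
Proof.
  exists (rsum (fun j => rsum (fun k =>
    Cmod (a j * Cconj (a k) * kern al (lam j - lam k))) n) n). intros t.
  rewrite energy_split. eapply Rle_trans; [apply rsum_Rabs|].
  rewrite <- rsum_scal_r. apply rsum_le; intros j _.
  eapply Rle_trans; [apply rsum_Rabs|].
  rewrite <- rsum_scal_r. apply rsum_le; intros k _.
  apply energy_term_bound.
Qed.

Lemma energy_limit n lam al a : (0 < al)%R -> is_lim (energy n lam al a) p_infty 0.
Proof.
  intros Hal. destruct (energy_bound n lam al a) as (M & HM).
  assert (H : is_lim (fun t => M * exp (- al * t))%R p_infty 0).
  { replace (Finite 0) with (Rbar_mult M 0) by (simpl; f_equal; ring).
    apply is_lim_scal_l.
    apply is_lim_comp with m_infty; [apply is_lim_exp_m| |now exists 0%R].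
    replace m_infty with (Rbar_mult (- al)%R p_infty).
    - apply is_lim_scal_l. apply is_lim_id.
    - simpl. destruct (Rle_dec 0 (- al)); [exfalso; lra|easy]. }
  apply (is_lim_le_le_loc (fun t => - (M * exp (- al * t)))%R (fun t => M * exp (- al * t))%R).
  - exists 0%R. intros t _. apply Rabs_le_between. apply HM.
  - replace (Finite 0) with (Rbar_opp 0) by (simpl; f_equal; ring).
    now apply is_lim_opp.
  - exact H.
Qed.

Lemma energy_lower_bound n lam al a T B : (0 < al)%R ->
  (forall t, T < t -> B <= energy n lam al a t) -> B <= 0.
Proof.
  intros Hal H.
  apply (is_lim_le_loc (fun _ => B) (energy n lam al a) p_infty B 0).
  - now exists T.
  - apply is_lim_const.
  - now apply energy_limit.
Qed.

(** A decreasing function with limit 0 is nonnegative; at [t = 0] this is positive semidefiniteness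
    of the Gram matrix. *)
Lemma energy_nonneg n lam al a t : (0 < al)%R -> 0 <= energy n lam al a t.
Proof.
  intros Hal.
  apply (is_lim_le_loc (energy n lam al a) (fun _ => energy n lam al a t) p_infty
    0 (energy n lam al a t)).
  - exists t. intros x Hx. apply energy_decr; lra.
  - now apply energy_limit.
  - apply is_lim_const.
Qed.

(** * Point evaluation at 0 on the half-line *)

Lemma gram_extremal n lam al r :
  csum r n = RtoC (INR n * al) ->
  (forall j, (j < n)%nat ->
    csum (fun k => Cconj (r k) * kern al (lam j - lam k)) n = 1) ->
  gram n lam al r = RtoC (INR n * al).
Proof.
  intros Hsum Hr. unfold gram. rewrite <- Hsum. apply csum_ext; intros j Hj.
  rewrite Hr by easy. ring.
Qed.

(** The hypotheses make [r] the reproducing kernel at 0. Removing from [a] its projection on [r]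
    leaves the squared norm [gram a - Cmod (csum a n) ^ 2 / S], which is nonnegative. *)
Lemma point_evaluation_bound n lam al r a : (0 < al)%R -> (1 <= n)%nat ->
  csum r n = RtoC (INR n * al) ->
  (forall j, (j < n)%nat ->
    csum (fun k => Cconj (r k) * kern al (lam j - lam k)) n = 1) ->
  (Cmod (csum a n) ^ 2 <= INR n * al * Re (gram n lam al a))%R.
Proof.
  intros Hal Hn Hsum Hr. set (S := (INR n * al)%R).
  assert (HS : (0 < S)%R).
  { apply Rmult_lt_0_compat; [apply lt_0_INR; lia|easy]. }
  assert (HS' : RtoC S <> 0) by (intros H; apply RtoC_inj in H; lra).
  (* The projection coefficient: the inner product of [a] with [r] is [csum a n], and that of [r]
     with itself is [S]. *)
  set (x := csum a n / RtoC S).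
  set (A := fun j => csum (fun k => Cconj (a k) * kern al (lam j - lam k)) n).
  assert (H1 : gram n lam al (fun j => a j - x * r j) =
    csum (fun j => (a j - x * r j) * (A j - Cconj x)) n).
  { apply csum_ext; intros j Hj. f_equal.
    rewrite (csum_ext _ _ (fun k => Cconj (a k) * kern al (lam j - lam k)
       + (- Cconj x) * (Cconj (r k) * kern al (lam j - lam k)))).
    - rewrite csum_plus, csum_scal, Hr by easy. unfold A. ring.
    - intros k _. rewrite Cminus_conj, Cmult_conj. ring. }
  (* The reproducing property with the arguments exchanged, by Hermitian symmetry of the kernel. *)
  assert (H2 : csum (fun j => r j * A j) n = Cconj (csum a n)).
  { unfold A. rewrite (csum_ext _ _ (fun j => csum (fun k =>
       r j * (Cconj (a k) * kern al (lam j - lam k))) n))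
      by (intros; now rewrite csum_scal).
    rewrite csum_swap, csum_conj. apply csum_ext; intros k Hk.
    rewrite (csum_ext _ _ (fun j => Cconj (a k) *
      Cconj (Cconj (r j) * kern al (lam k - lam j)))).
    - rewrite csum_scal, <- csum_conj, Hr by easy.
      replace (Cconj 1) with (RtoC 1) by (unfold Cconj; simpl; now rewrite Ropp_0).
      ring.
    - intros j _. rewrite Cmult_conj, Cconj_conj, kern_conj, Ropp_minus_distr by easy. ring. }
  assert (H3 : gram n lam al (fun j => a j - x * r j) =
    gram n lam al a - x * Cconj (csum a n)).
  { rewrite H1, (csum_ext _ _ (fun j => a j * A j + ((- x) * (r j * A j) +
      ((- Cconj x) * a j + Cconj x * x * r j)))) by (intros; ring).
    rewrite !csum_plus, !csum_scal, H2, Hsum. fold S.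
    unfold x at 4. unfold gram, A. field. easy. }
  assert (H4 : x * Cconj (csum a n) = RtoC (Cmod (csum a n) ^ 2 / S)).
  { rewrite RtoC_div by lra. rewrite Cmod2_conj. unfold x. field. easy. }
  rewrite H4 in H3. apply (f_equal Re) in H3.
  assert (H5 := energy_nonneg n lam al (fun j => a j - x * r j) 0 Hal).
  rewrite energy_0, H3 in H5. simpl in H5.
  assert (H6 : (Cmod (csum a n) ^ 2 / S <= Re (gram n lam al a))%R).
  { simpl. unfold Re. lra. }
  apply (Rmult_le_compat_l S) in H6; [|lra].
  replace (S * (Cmod (csum a n) ^ 2 / S))%R with (Cmod (csum a n) ^ 2)%R in H6 by (field; lra).
  exact H6.
Qed.

(* Comparison of the mass beyond 1 with the mass on the unit interval *)
Close Scope C_scope.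

(** [wsq_shift] integrated over the cell from [(m + n) h] to [(m + n + 1) h]. The shift by
    [(m + 1 + k) h] with [k < n] carries this cell into [[0, n h]], hence into [[0, 1]]. *)
Lemma energy_grid_step n lam al h a m : 0 < al -> 0 < h -> INR n * h <= 1 ->
  energy n lam al a (INR (m + n) * h) - energy n lam al a (INR (S m + n) * h) <=
  ((4/3) ^ m * 8 ^ n) ^ 2 * exp (- al * (INR (S m) * h)) *
  (energy n lam al a 0 - energy n lam al a 1).
Proof.
  intros Hal Hh Hn1.
  destruct (wsq_shift n m lam al h Hal Hh) as (c & Hc0 & HcK & Hc).
  set (K := (4/3) ^ m * 8 ^ n) in *.
  set (X := exp (- al * (INR (S m) * h))) in *.
  assert (HK : 0 < K) by (apply Rmult_lt_0_compat; apply pow_lt; lra).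
  assert (HX : 0 < X) by apply exp_pos.
  set (E := energy n lam al a) in *.
  set (J := E 0 - E 1).
  assert (Hmono : forall s t, s <= t -> E t <= E s)
    by (intros; now apply energy_decr).
  (* The integration is done by monotonicity: by [wsq_shift] the derivative of [G] is
     nonpositive. *)
  set (G := fun t => K * X * rsum (fun k => c k * E (t - INR (S m + k) * h)) n - E t).
  assert (HG : G (INR (S m + n) * h) <= G (INR (m + n) * h)).
  { apply (derive_nonpos_decr G (fun t => K * X *
      rsum (fun k => c k * - wsq n lam al a (t - INR (S m + k) * h)) n
      - - wsq n lam al a t)).
    - intros t. unfold G. apply (is_derive_minus (V := R_NormedModule)).
      + apply (is_derive_scal (fun t => rsum (fun k => c k * E (t - INR (S m + k) * h)) n)).
        apply (rsum_derive n (fun k t => c k * E (t - INR (S m + k) * h))).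
        intros k. apply (is_derive_scal (fun t => E (t - INR (S m + k) * h))).
        rewrite <- (Rmult_1_l (- _)).
        apply (is_derive_comp E (fun t => t - INR (S m + k) * h)).
        * now apply energy_derive.
        * auto_derive; [easy|ring].
      + now apply energy_derive.
    - intros t _. generalize (Hc a t).
      rewrite (rsum_ext _ (fun k => c k * - _ )
        (fun k => (- (1)) * (c k * wsq n lam al a (t - INR (S m + k) * h))))
        by (intros; ring).
      rewrite rsum_scal. lra.
    - apply Rmult_le_compat_r; [lra|]. apply le_INR; lia. }
  unfold G in HG.
  set (s1 := rsum (fun k => c k * E (INR (S m + n) * h - INR (S m + k) * h)) n) in HG.
  set (s0 := rsum (fun k => c k * E (INR (m + n) * h - INR (S m + k) * h)) n) in HG.
  assert (Hs : s0 - s1 <= K * J).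
  { apply Rle_trans with (rsum c n * J).
    - rewrite <- rsum_scal_r.
      replace (s0 - s1) with (s0 + (- (1)) * s1) by ring.
      unfold s0, s1. rewrite <- rsum_scal, <- rsum_plus.
      apply rsum_le; intros k Hk.
      match goal with |- ?l <= _ => replace l with
        (c k * (E (INR (m + n) * h - INR (S m + k) * h) -
                E (INR (S m + n) * h - INR (S m + k) * h))) by ring end.
      apply Rmult_le_compat_l; [apply Hc0|]. unfold J.
      assert (E (INR (m + n) * h - INR (S m + k) * h) <= E 0).
      { apply Hmono. assert (INR (S m + k) <= INR (m + n)) by (apply le_INR; lia). nra. }
      assert (E 1 <= E (INR (S m + n) * h - INR (S m + k) * h)).
      { apply Hmono. rewrite !plus_INR.
        assert (0 <= INR k) by apply pos_INR. nra. }
      lra.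
    - apply Rmult_le_compat_r; [|easy]. unfold J.
      assert (E 1 <= E 0) by (apply Hmono; lra). lra. }
  assert (K * X * (s0 - s1) <= K * X * (K * J)).
  { apply Rmult_le_compat_l; [|easy]. apply Rmult_le_pos; lra. }
  replace (K ^ 2 * X * J) with (K * X * (K * J)) by ring. lra.
Qed.

Lemma exp_INR_mult k x : exp (INR k * x) = exp x ^ k.
Proof.
  induction k as [|k IH]; [now rewrite Rmult_0_l, exp_0|].
  rewrite S_INR, Rmult_plus_distr_r, Rmult_1_l, exp_plus, IH. simpl; ring.
Qed.

(** The exponent is [al * h] for [al = 9n] and [h = 1/(4n)]; the bound is the ninth power of
    [1 + 1/4 <= exp (1/4)], inverted. *)
Lemma exp_neg_9_4 : exp (- (9/4)) <= (4/5) ^ 9.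
Proof.
  assert (H : 5/4 <= exp (1/4)) by (generalize (exp_ineq1_le (1/4)); lra).
  assert (H9 : (5/4) ^ 9 <= exp (9/4)).
  { replace (exp (9/4)) with (exp (1/4) ^ 9).
    - apply pow_incr; lra.
    - rewrite <- exp_INR_mult. f_equal. simpl; lra. }
  rewrite exp_Ropp. replace ((4/5) ^ 9) with (/ (5/4) ^ 9) by (simpl; field).
  apply Rinv_le_contravar; [simpl; lra|easy].
Qed.

(** With [r = 16/9 * x] the left side is [(64 r^3)^n * r^i * x]. Numerically
    [64 r^3 <= 9/10 <= exp (-1/10)], [r <= 1/4] and [x <= 3/4]; the right side is a difference so
    that the sum over [i] telescopes. *)
Lemma step_factor_bound n i :
  ((4/3) ^ (3 * n + i) * 8 ^ n) ^ 2 * exp (- (9/4)) ^ S (3 * n + i) <=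
  exp (- INR n / 10) * ((1/4) ^ i - (1/4) ^ S i).
Proof.
  set (x := exp (- (9/4))).
  assert (Hx0 : 0 < x) by apply exp_pos.
  assert (Hx : x <= (4/5) ^ 9) by apply exp_neg_9_4.
  simpl in Hx.
  replace (((4/3) ^ (3 * n + i) * 8 ^ n) ^ 2 * x ^ S (3 * n + i))
    with ((64 * (16/9 * x) ^ 3) ^ n * ((16/9 * x) ^ i * x)).
  2:{ replace (64 * (16/9 * x) ^ 3)
        with (8 * 8 * (4/3 * (4/3) * x) * (4/3 * (4/3) * x) * (4/3 * (4/3) * x)) by field.
      replace (16/9 * x) with (4/3 * (4/3) * x) by field.
      replace (3 * n)%nat with (n + n + n)%nat by lia.
      rewrite <- (tech_pow_Rmult x), !pow_add, !Rpow_mult_distr. ring. }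
  assert (Hr : 16/9 * x <= 1/4) by lra.
  assert (H1 : (64 * (16/9 * x) ^ 3) ^ n <= exp (- INR n / 10)).
  { replace (- INR n / 10) with (INR n * (- (1/10))) by field.
    rewrite exp_INR_mult. apply pow_incr. split.
    - apply Rmult_le_pos; [lra|apply pow_le; lra].
    - apply Rle_trans with (64 * (16/9 * ((4/5) ^ 9)) ^ 3).
      + apply Rmult_le_compat_l; [lra|]. apply pow_incr; simpl; lra.
      + generalize (exp_ineq1_le (- (1/10))). simpl. lra. }
  assert (H2 : (16/9 * x) ^ i * x <= (1/4) ^ i - (1/4) ^ S i).
  { assert (H3 : (16/9 * x) ^ i <= (1/4) ^ i) by (apply pow_incr; lra).
    assert (H4 : 0 < (16/9 * x) ^ i) by (apply pow_lt; lra).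
    simpl. nra. }
  apply Rmult_le_compat; [| |easy|easy].
  - apply pow_le. apply Rmult_le_pos; [lra|apply pow_le; lra].
  - apply Rmult_le_pos; [apply pow_le|]; lra.
Qed.

Lemma energy_tail n lam a : (1 <= n)%nat ->
  energy n lam (9 * INR n) a 1 <=
  exp (- INR n / 10) * (energy n lam (9 * INR n) a 0 - energy n lam (9 * INR n) a 1).
Proof.
  intros Hn. assert (Hn0 : 1 <= INR n) by (apply (le_INR 1); easy).
  set (al := 9 * INR n). assert (Hal : 0 < al) by (unfold al; lra).
  set (h := / (4 * INR n)).
  assert (Hh : 0 < h) by (apply Rinv_0_lt_compat; lra).
  assert (Hnh : INR n * h = 1/4) by (unfold h; field; lra).
  set (E := energy n lam al a). set (J := E 0 - E 1). set (X := exp (- INR n / 10)).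
  assert (Hmono : forall s t, s <= t -> E t <= E s)
    by (intros; now apply energy_decr).
  assert (HJ : 0 <= J) by (unfold J; assert (E 1 <= E 0) by (apply Hmono; lra); lra).
  (* The cells start at [4 n h = 1], matching [m = 3n + i] in [energy_grid_step]. *)
  assert (Hgrid : forall i,
    E 1 - E (INR (4 * n + i) * h) <= X * (1 - (1/4) ^ i) * J).
  { induction i as [|i IH].
    - rewrite Nat.add_0_r, mult_INR.
      replace (INR 4 * INR n * h) with 1 by (rewrite Rmult_assoc, Hnh; simpl; lra).
      simpl. lra.
    - assert (H := energy_grid_step n lam al h a (3 * n + i) Hal Hh).
      replace (3 * n + i + n)%nat with (4 * n + i)%nat in H by lia.
      replace (S (3 * n + i) + n)%nat with (4 * n + S i)%nat in H by lia.
      replace (- al * (INR (S (3 * n + i)) * h))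
        with (INR (S (3 * n + i)) * (- (9/4))) in H
        by (unfold al, h; field; lra).
      rewrite exp_INR_mult in H. fold E in H. fold J in H.
      assert (H2 := step_factor_bound n i). fold X in H2.
      apply (Rmult_le_compat_r J) in H2; [|easy].
      lra. }
  apply Rminus_le. apply (energy_lower_bound n lam al a 0); [easy|].
  intros t Ht. fold E.
  (* A grid point beyond [t] bounds [E t] from below, and [energy_lower_bound] then lets [t] tend to
     infinity. *)
  destruct (INR_archimed h t Hh) as (i & Hi).
  assert (H1 := Hgrid i).
  assert (H2 : E (INR (4 * n + i) * h) <= E t).
  { apply Hmono. rewrite plus_INR. generalize (pos_INR (4 * n)). nra. }
  assert (H3 : 0 <= X * (1/4) ^ i * J).
  { apply Rmult_le_pos; [|easy]. apply Rmult_le_pos; [left; apply exp_pos|].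
    apply pow_le; lra. }
  lra.
Qed.

(** * Translation to real and imaginary parts and to the Riemann integral *)

Lemma strictly_incr_lt n lam : strictly_incr n lam ->
  forall j k, (j < k < n)%nat -> lam j < lam k.
Proof.
  intros H j k. induction k as [|k IH]; intros Hjk; [lia|].
  destruct (Nat.eq_dec j k) as [->|Hne]; [apply H; lia|].
  apply Rlt_trans with (lam k); [apply IH; lia|apply H; lia].
Qed.

Lemma expsum_re_Re n lam p q t :
  expsum_re n lam p q t = Re (expsum n lam (fun j => (p j, q j)) t).
Proof. unfold expsum, expsum_re. now rewrite re_csum. Qed.

Lemma expsum_im_Im n lam p q t :
  expsum_im n lam p q t = Im (expsum n lam (fun j => (p j, q j)) t).
Proof. unfold expsum, expsum_im. now rewrite im_csum. Qed.

Lemma expsum_abs_Cmod n lam p q t :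
  expsum_abs n lam p q t = Cmod (expsum n lam (fun j => (p j, q j)) t).
Proof. unfold expsum_abs. now rewrite expsum_re_Re, expsum_im_Im. Qed.

Lemma weighted_sq_wsq n lam p q t :
  weighted_sq n lam p q t = wsq n lam (9 * INR n) (fun j => (p j, q j)) t.
Proof.
  unfold weighted_sq, wsq.
  rewrite <- expsum_abs_Cmod. unfold expsum_abs. rewrite pow2_sqrt; [easy|].
  apply Rplus_le_le_0_compat; apply pow2_ge_0.
Qed.

Lemma expsum_at_0 n lam a : expsum n lam a 0 = csum a n.
Proof.
  unfold expsum. apply csum_ext; intros j _.
  now rewrite Rmult_0_r, cis_0, Cmult_1_r.
Qed.

Lemma weighted_sq_continuous n lam p q t : continuous (weighted_sq n lam p q) t.
Proof.
  apply (ex_derive_continuous (V := R_NormedModule)).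
  assert (Hre : exists l, is_derive (expsum_re n lam p q) t l).
  { exists (rsum (fun j => - (p j * sin (lam j * t) * lam j)
                        - q j * cos (lam j * t) * lam j) n).
    apply (rsum_derive n (fun j t => p j * cos (lam j * t) - q j * sin (lam j * t))).
    intros j. auto_derive; [easy|ring]. }
  assert (Him : exists l, is_derive (expsum_im n lam p q) t l).
  { exists (rsum (fun j => p j * cos (lam j * t) * lam j
                        - q j * sin (lam j * t) * lam j) n).
    apply (rsum_derive n (fun j t => p j * sin (lam j * t) + q j * cos (lam j * t))).
    intros j. auto_derive; [easy|ring]. }
  unfold weighted_sq. auto_derive. repeat split; [exact Hre|exact Him].
Qed.

Lemma weighted_sq_is_RInt n lam p q : (1 <= n)%nat ->
  is_RInt (weighted_sq n lam p q) 0 1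
    (energy n lam (9 * INR n) (fun j => (p j, q j)) 0
     - energy n lam (9 * INR n) (fun j => (p j, q j)) 1).
Proof.
  intros Hn. assert (Hn0 : 1 <= INR n) by (apply (le_INR 1); easy).
  set (E := energy n lam (9 * INR n) (fun j => (p j, q j))).
  replace (E 0 - E 1) with (minus (- E 1) (- E 0)) by (unfold minus, plus, opp; simpl; ring).
  apply (is_RInt_derive (fun t => - E t) (weighted_sq n lam p q)).
  - intros t _. rewrite weighted_sq_wsq, <- (Ropp_involutive (wsq _ _ _ _ _)).
    apply (is_derive_opp E). apply energy_derive. lra.
  - intros t _. apply weighted_sq_continuous.
Qed.

Lemma weighted_sq_RiemannInt n lam p q
  (pr : Riemann_integrable (weighted_sq n lam p q) 0 1) : (1 <= n)%nat ->
  RiemannInt pr = energy n lam (9 * INR n) (fun j => (p j, q j)) 0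
     - energy n lam (9 * INR n) (fun j => (p j, q j)) 1.
Proof.
  intros Hn. rewrite <- RInt_Reals. apply is_RInt_unique. now apply weighted_sq_is_RInt.
Qed.

(** * Extremal coefficients and the two bounds *)

(** The solution of [cauchy_system] is conjugated because [gram] is conjugate-linear in its second
    argument; its sum is real and does not change. *)
Lemma extremal_coefficients n lam al : 0 < al -> strictly_incr n lam ->
  exists r : nat -> C, csum r n = RtoC (INR n * al) /\
    forall j, (j < n)%nat ->
      csum (fun k => Cconj (r k) * kern al (lam j - lam k))%C n = RtoC 1.
Proof.
  intros Hal Hl. destruct (cauchy_system n lam al Hal) as (s & Hs & Hk).
  { intros j k Hjk. apply Rlt_not_eq. now apply (strictly_incr_lt n). }
  exists (fun k => Cconj (s k)). split.
  - rewrite <- csum_conj, Hs. unfold Cconj; simpl. now rewrite Ropp_0.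
  - intros j Hj. rewrite <- (Hk j Hj). apply csum_ext; intros k _.
    now rewrite Cconj_conj.
Qed.

(* A vanishing tail would make the exponential sum zero on [(1, oo)], and
   [expsum_shift] with a negative step would propagate this to the origin. *)
Lemma energy_pos n lam al a : 0 < al -> csum a n <> RtoC 0 -> 0 < energy n lam al a 1.
Proof.
  intros Hal Ha. apply Rnot_le_lt. intros H. apply Ha.
  assert (Hz : forall t, 1 <= t -> energy n lam al a t = 0).
  { intros t Ht. apply Rle_antisym; [|now apply energy_nonneg].
    apply Rle_trans with (energy n lam al a 1); [now apply energy_decr|easy]. }
  assert (Hf : forall t, 1 < t -> expsum n lam a t = RtoC 0).
  { intros t Ht.
    assert (Hw : wsq n lam al a t = 0).
    { assert (D1 := is_derive_unique _ _ _ (energy_derive n lam al a t Hal)).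
      assert (D2 : is_derive (energy n lam al a) t 0).
      { apply (is_derive_ext_loc (fun _ => 0)).
        - apply (locally_open (fun u => 1 < u)); [apply open_gt| |easy].
          intros u Hu. symmetry. apply Hz. lra.
        - apply (is_derive_const (V := R_NormedModule)). }
      apply is_derive_unique in D2. lra. }
    unfold wsq in Hw. apply Cmod_eq_0.
    apply Rmult_integral in Hw. destruct Hw as [Hw|Hw].
    - apply Rsqr_0_uniq. unfold Rsqr. simpl in Hw. lra.
    - generalize (exp_pos (- al * t)). lra. }
  (* With [m = 1] and [h = -1] the value at 0 is a combination of values at [2 + k], all beyond
     1. *)
  destruct (expsum_shift n 1 lam (- (1))) as (c & _ & Hc).
  rewrite <- (expsum_at_0 n lam a), Hc.
  rewrite (csum_ext _ _ (fun _ => RtoC 0)); [apply csum_zero|].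
  intros k _. rewrite Hf; [ring|]. rewrite plus_INR.
  generalize (pos_INR k). simpl. lra.
Qed.

Theorem theorem3p2 (n : nat) (hn : (1 <= n)%nat) (eps : R)
  (heps : 0 < eps) (hdef : (1 + eps) ^ 2 = 1 + 8190 * exp (- INR n / 10)) :
  (forall (lam p q : nat -> R), strictly_incr n lam ->
     forall pr : Riemann_integrable (weighted_sq n lam p q) 0 1,
       expsum_abs n lam p q 0 <= (1 + eps) * (3 * INR n) * sqrt (RiemannInt pr))
  /\
  (forall lam : nat -> R, strictly_incr n lam ->
     exists (p q : nat -> R) (pr : Riemann_integrable (weighted_sq n lam p q) 0 1),
       expsum_abs n lam p q 0 > 3 * INR n * sqrt (RiemannInt pr)).
Proof.
  assert (Hn0 : 1 <= INR n) by (apply (le_INR 1); easy).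
  assert (Hal : 0 < 9 * INR n) by lra.
  split; intros lam.
  - intros p q Hl pr.
    destruct (extremal_coefficients n lam _ Hal Hl) as (r & Hs & Hr).
    rewrite weighted_sq_RiemannInt, expsum_abs_Cmod, expsum_at_0 by easy.
    set (a := fun j => (p j, q j)).
    assert (H1 := point_evaluation_bound n lam _ r a Hal hn Hs Hr).
    rewrite <- energy_0 in H1.
    assert (H2 := energy_tail n lam a hn).
    set (E := energy n lam (9 * INR n) a) in *. set (J := E 0 - E 1) in *.
    set (X := exp (- INR n / 10)) in *.
    assert (HX : 0 < X) by apply exp_pos.
    assert (HJ : 0 <= J).
    { assert (E 1 <= E 0) by (apply energy_decr; lra). unfold J; lra. }
    apply Rsqr_incr_0_var.
    2:{ apply Rmult_le_pos; [apply Rmult_le_pos; lra|apply sqrt_pos]. }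
    rewrite !Rsqr_mult, Rsqr_sqrt, !Rsqr_pow2, hdef by easy.
    apply Rle_trans with (INR n * (9 * INR n) * E 0); [easy|].
    replace ((1 + 8190 * X) * (3 ^ 2 * INR n ^ 2) * J)
      with (INR n * (9 * INR n) * ((1 + 8190 * X) * J)) by ring.
    apply Rmult_le_compat_l; [apply Rmult_le_pos; lra|].
    assert (0 <= X * J) by (apply Rmult_le_pos; lra).
    (* [energy_tail] gives [E 0 <= (1 + X) * J], within the factor [1 + 8190 * X]. *)
    replace (E 0) with (J + E 1) by (unfold J; ring). lra.
  - intros Hl.
    destruct (extremal_coefficients n lam _ Hal Hl) as (r & Hs & Hr).
    set (p := fun j => fst (r j)). set (q := fun j => snd (r j)).
    assert (Hpq : forall j, (p j, q j) = r j) by (intros; unfold p, q; now destruct (r j)).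
    assert (pr : Riemann_integrable (weighted_sq n lam p q) 0 1).
    { apply ex_RInt_Reals_0. eexists. now apply weighted_sq_is_RInt. }
    exists p, q, pr.
    rewrite weighted_sq_RiemannInt, expsum_abs_Cmod, expsum_at_0 by easy.
    set (a := fun j => (p j, q j)).
    assert (Ha : csum a n = RtoC (INR n * (9 * INR n))).
    { rewrite <- Hs. apply csum_ext; intros; apply Hpq. }
    assert (HS : 0 < INR n * (9 * INR n)) by (apply Rmult_lt_0_compat; lra).
    assert (HE0 : energy n lam (9 * INR n) a 0 = INR n * (9 * INR n)).
    { rewrite energy_0, (gram_extremal n lam (9 * INR n) a); [easy|easy|].
      intros j Hj. rewrite <- (Hr j Hj). apply csum_ext; intros k _.
      unfold a. now rewrite Hpq. }
    assert (HE1 : 0 < energy n lam (9 * INR n) a 1).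
    { apply energy_pos; [easy|]. rewrite Ha. intros H. apply RtoC_inj in H. lra. }
    (* The value at 0 and the squared norm on the half-line are both [9 n^2]; the strict gain is the
       tail [e]. *)
    rewrite Ha, Cmod_R, Rabs_pos_eq, HE0 by lra.
    set (e := energy n lam (9 * INR n) a 1) in *.
    apply Rle_lt_trans with (3 * INR n * sqrt (INR n * (9 * INR n) - e)); [apply Rle_refl|].
    replace (INR n * (9 * INR n)) with (3 * INR n * (3 * INR n)) at 2 by ring.
    apply Rmult_lt_compat_l; [lra|].
    (* [sqrt] is 0 on negative reals, so a negative radicand is settled at once. *)
    destruct (Rle_lt_dec 0 (INR n * (9 * INR n) - e)) as [H|H].
    + rewrite <- (sqrt_Rsqr (3 * INR n)) by lra.
      apply sqrt_lt_1; [easy|apply Rle_0_sqr|unfold Rsqr; lra].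
    + rewrite sqrt_neg_0 by lra. lra.
Qed.
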